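(* $\mathbb{F}_2$ is not Borel weakly compact.
   Context: $\mathbb{F}_2$ is the equivalence relation on $(2^{\omega})^{\omega}$ given by $\bar{x} \mathrel{\mathbb{F}_2} \bar{y}$ iff $\{x_n : n\in\omega\}=\{y_n : n \in\omega\}$. For equivalence relations $E$, $F$ on $X$, $Y$, $E\leq_B F$ means there is a Borel map $\varphi: X\to Y$ with $x_1 \mathrel{E} x_2 \Leftrightarrow \varphi(x_1) \mathrel{F} \varphi(x_2)$. $E\upharpoonright A$ denotes the restriction of $E$ to $A$. A Borel equivalence relation $E$ on a Polish space $X$ is Borel weakly compact if for every symmetric $E\times E$-invariant Borel function $f: X^2\to 2$ (i.e. $f(x,y)=f(y,x)$, and $f(x,y)=f(x',y')$ whenever $x \mathrel{E} x'$ and $y \mathrel{E} y'$) there is a Borel set $A\subseteq X$ with $E\leq_B E\upharpoonright A$ such that $f$ is constant on $A^2\setminus E$. *)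

(* Defs.v *)
(* Library: MathComp-Analysis. *)
From Stdlib Require Import RelationClasses.
From mathcomp Require Import all_boot all_classical.
From mathcomp Require Import topology measure cantor.

Set Implicit Arguments.
Unset Strict Implicit.
Unset Printing Implicit Defensive.

Local Open Scope classical_set_scope.

(* [measurableType] requires a pointed carrier, which a subspace need not have;
   hence the Borel sets are given directly as a family of sets. *)
Definition borel {X : topologicalType} : set (set X) := <<s @open X >>.

Definition borel_map {X Y : topologicalType} (f : X -> Y) : Prop :=
  forall B : set Y, borel B -> borel (f @^-1` B).

Definition borel_reducible {X Y : topologicalType}
    (E : X -> X -> Prop) (F : Y -> Y -> Prop) : Prop :=
  exists2 phi : X -> Y,
    borel_map phi & forall x1 x2, E x1 x2 <-> F (phi x1) (phi x2).

(* The coercion of [A : set X] to a type is the subtype [set_type A], which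
   carries the subspace topology. *)
Definition rel_restrict {X : topologicalType} (E : X -> X -> Prop)
    (A : set X) (x y : A) : Prop :=
  E (set_val x) (set_val y).

(* Meant for Borel equivalence relations on Polish spaces; [X * X] carries the
   product topology and [bool] the discrete one. *)
Definition borel_weakly_compact {X : topologicalType}
    (E : X -> X -> Prop) : Prop :=
  forall f : X * X -> bool,
    borel_map f ->
    (forall x y, f (x, y) = f (y, x)) ->
    (forall x x' y y', E x x' -> E y y' -> f (x, y) = f (x', y')) ->
    exists A : set X,
      [/\ borel A,
          borel_reducible E (@rel_restrict X E A) &
          exists c : bool,
            forall x y, A x -> A y -> ~ E x y -> f (x, y) = c].

Definition cantor_sequences : topologicalType :=
  prod_topology (fun _ : nat => cantor_space).

Definition F2 (x y : cantor_sequences) : Prop := range x = range y.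

Lemma F2_equivalence : Equivalence F2.
Proof. by split=> [x|x y|x y z] //; rewrite /F2 => ->. Qed.

Lemma F2_borel : borel [set p : cantor_sequences * cantor_sequences | F2 p.1 p.2].
Proof.
pose XX : topologicalType := (cantor_sequences * cantor_sequences)%type.
have sX : sigma_algebra [set: XX] borel by exact: smallest_sigma_algebra.
have bU (F : nat -> set XX) : (forall i, borel (F i)) -> borel (\bigcup_i F i).
  by case: sX => _ _; apply.
have bC (A : set XX) : borel A -> borel (~` A).
  by case: sX => _ + _ => /[apply]; rewrite setTD.
have bI (F : nat -> set XX) : (forall i, borel (F i)) -> borel (\bigcap_i F i).
  move=> bF; rewrite -[X in borel X]setCK setC_bigcap; apply: (bC).
  by apply: bU => i; exact: bC.
have coordc n k : continuous (fun x : cantor_sequences => (x n : cantor_space) k).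
  move=> x; apply: (@continuous_comp _ _ _ (fun x : cantor_sequences => x n)
    (fun z : cantor_space => z k)).
    exact: (@proj_continuous nat (fun=> cantor_space) n).
  exact: (@proj_continuous nat (fun=> bool) k).
have bE n m : borel [set p : XX | p.1 n = p.2 m].
  have -> : [set p : XX | p.1 n = p.2 m] =
      \bigcap_k [set p : XX | (p.1 n : cantor_space) k
                              = (p.2 m : cantor_space) k].
    apply/seteqP; split=> [p /= e k _ /=|p /= e]; first by rewrite e.
    by apply/funext => k; exact: e k I.
  apply: bI => k; apply: sub_sigma_algebra.
  have -> : [set p : XX | (p.1 n : cantor_space) k = (p.2 m : cantor_space) k] =
    \bigcup_b ([set p : XX | (p.1 n : cantor_space) k = b] `&`
               [set p : XX | (p.2 m : cantor_space) k = b]).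
    apply/seteqP; split=> [p /= e|p [b _ [/= -> ->]] //].
    by exists ((p.2 m : cantor_space) k).
  apply: bigcup_open => b _; apply: openI.
    apply: (@open_comp _ _ (fun p : XX => (p.1 n : cantor_space) k) [set b]).
      move=> p _; apply: (@continuous_comp _ _ _ (fst : XX -> cantor_sequences)
        (fun x : cantor_sequences => (x n : cantor_space) k)).
        exact: cvg_fst.
      exact: coordc.
    exact: discrete_open.
  apply: (@open_comp _ _ (fun p : XX => (p.2 m : cantor_space) k) [set b]).
    move=> p _; apply: (@continuous_comp _ _ _ (snd : XX -> cantor_sequences)
        (fun x : cantor_sequences => (x m : cantor_space) k)).
        exact: cvg_snd.
      exact: coordc.
  exact: discrete_open.
have -> : [set p : XX | F2 p.1 p.2] =
    ~` (~` (\bigcap_n \bigcup_m [set p : XX | p.1 n = p.2 m]) `|`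
        ~` (\bigcap_m \bigcup_n [set p : XX | p.1 n = p.2 m])).
  rewrite setCU !setCK; apply/seteqP; split=> [p /= e|p [h1 h2]].
    split=> n _.
      have [m _ em] : range p.2 (p.1 n) by rewrite -e; exists n.
      by exists m => //=; rewrite em.
    have [m _ em] : range p.1 (p.2 n) by rewrite e; exists n.
    by exists m.
  apply/seteqP; split=> _ [n _ <-].
    by have [m _ /= ->] := h1 n I; exists m.
  by have [m _ /= <-] := h2 n I; exists m.
apply: (bC); rewrite -bigcup2E; apply: (bU) => -[|[|i]] /=.
- by apply: (bC); apply: (bI) => n; apply: (bU) => m; exact: bE.
- by apply: (bC); apply: (bI) => m; apply: (bU) => n; exact: bE.
- by case: sX.
Qed.

(* Main.v *)
(* Colour a pair by whether the two ranges are comparable under inclusion, and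
   let Phi be a Borel reduction of F2 to itself.

   Some inequivalent x, y have Phi-images with incomparable ranges: otherwise
   compare the images of (enumerations of) the E_0-classes of u and of its
   complement.  The set of u for which the first image lies inside the second
   is E_0-invariant, hence meager or comeager; since complementation exchanges
   the two inclusions, both hold for a generic u, against injectivity of the
   reduction on classes.

   Some inequivalent x, y have Phi-images with comparable ranges: give the set
   of reals the discrete topology, so that finite sequences of reals are the
   forcing conditions.  If the range of y is a countable set closed under
   enough witnesses, a real lies in the range of Phi y iff some finite sequence
   of elements of range y forces it to be a coordinate of Phi.  This
   description is monotone in range y. *)
Require Import Defs.
From mathcomp Require Import all_boot all_classical.
From mathcomp Require Import topology measure cantor.

Set Implicit Arguments.
Unset Strict Implicit.
Unset Printing Implicit Defensive.

Local Open Scope classical_set_scope.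

(** * Baire category for sequences over a discrete set *)

Section GenericSequences.
Variable T : Type.
Implicit Types (a b : seq T) (u : nat -> T) (P : seq T -> Prop).

Definition hits u P := exists k, P (mkseq u k).
Definition dense_cond P := forall a, exists b, P (a ++ b).
Definition upclosed P := forall a b, P a -> P (a ++ b).

Lemma mkseq_leq u k l : k <= l -> exists b, mkseq u l = mkseq u k ++ b.
Proof.
move=> kl; exists (map u (iota k (l - k))).
by rewrite /mkseq -map_cat -{2}[k]add0n -iotaD subnKC.
Qed.

(** The Baire category argument: [c] meets the requirements one after another along the countable
    index set. Appending [t0] at each stage makes the lengths unbounded, so the limit [u] is defined
    everywhere. *)
Lemma generic_exists (t0 : T) (I : countType) (D : I -> seq T -> Prop) :
  (forall i, dense_cond (D i)) -> exists u, forall i, hits u (D i).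
Proof.
move=> dD.
have /choice [e eP] : forall p : I * seq T, exists b, D p.1 (p.2 ++ b).
  by move=> [i a]; exact: dD.
pose step n a := if unpickle n is Some i then a ++ e (i, a) else a.
pose c := fix c n := if n is n'.+1 then rcons (step n' (c n')) t0 else [::].
have cS n : exists b, c n.+1 = c n ++ b.
  rewrite /= /step; case: unpickle => [i|]; last by exists [:: t0]; rewrite cats1.
  by exists (e (i, c n) ++ [:: t0]); rewrite -cats1 catA.
have cle n m : n <= m -> exists b, c m = c n ++ b.
  elim: m => [|m IH]; first by rewrite leqn0 => /eqP ->; exists [::]; rewrite cats0.
  rewrite leq_eqVlt => /orP[/eqP ->|]; first by exists [::]; rewrite cats0.
  move=> /IH [b cb]; have [b' cb'] := cS m.
  by exists (b ++ b'); rewrite catA -cb.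
have csize n : n <= size (c n).
  elim: n => // n IH; rewrite /= size_rcons ltnS; apply: leq_trans IH _.
  by rewrite /step; case: unpickle => [i|] //; rewrite size_cat leq_addr.
pose u n := nth t0 (c n.+1) n.
have cu n a b : c n = a ++ b -> mkseq u (size a) = a.
  move=> cn; apply: (@eq_from_nth _ t0); first by rewrite size_mkseq.
  move=> i; rewrite size_mkseq => ia; rewrite nth_mkseq // /u.
  have -> : nth t0 a i = nth t0 (c n) i by rewrite cn nth_cat ia.
  have [ni|ni] := leqP i.+1 n.
    have [d ->] := cle _ _ ni.
    by rewrite nth_cat (leq_trans (ltnSn i)) // csize.
  have [d ->] := cle _ _ (ltnW ni); rewrite nth_cat.
  by rewrite cn size_cat (leq_trans ia) // leq_addr.
exists u => i; pose n := pickle i; exists (size (c n ++ e (i, c n))).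
rewrite (cu n.+1 _ [:: t0]); first exact: (eP (i, c n)).
by rewrite [LHS]/= /step pickleK cats1.
Qed.

(* Open modulo a meager set, for the product of discrete copies of [T]; [U]
   stands for the open set of all [u] having an initial segment in [U]. *)
Definition almost_open (B : set (nat -> T)) :=
  exists D : nat -> seq T -> Prop, exists U : seq T -> Prop,
    [/\ forall n, dense_cond (D n), upclosed U &
        forall u, (forall n, hits u (D n)) -> (B u <-> hits u U)].

(** Off the boundary of [U], the complement is the exterior [V]; avoiding the boundary is the extra
    requirement at index 0. *)
Lemma almost_openC B : almost_open B -> almost_open (~` B).
Proof.
move=> [D [U [dD Uup BU]]]; pose V a := forall b, ~ U (a ++ b).
exists (fun n => if n is n'.+1 then D n' else fun a => U a \/ V a), V; split.
- move=> [|n]; last exact: dD.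
  move=> a; have [[b Ub]|nU] := pselect (exists b, U (a ++ b)).
    by exists b; left.
  by exists [::]; rewrite cats0; right => b Ub; apply: nU; exists b.
- by move=> a b Va c; rewrite -catA.
- move=> u uD; rewrite /setC /= (BU u (fun n => uD n.+1)); split.
    move=> nU; have [k [Uk|Vk]] := uD 0; last by exists k.
    by case: nU; exists k.
  move=> [k Vk] [l Ul].
  have [kl|/ltnW lk] := leqP k l.
    have [b e] := mkseq_leq u kl; by apply: (Vk b); rewrite -e.
  have [b e] := mkseq_leq u lk; apply: (Vk [::]).
  by rewrite cats0 e; exact: Uup.
Qed.

Lemma almost_open_bigcup (B : nat -> set (nat -> T)) :
  (forall i, almost_open (B i)) -> almost_open (\bigcup_i B i).
Proof.
move=> /choice [D /choice [U DU]].
pose q n : nat * nat := odflt (0, 0) (unpickle n).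
exists (fun n => D (q n).1 (q n).2), (fun a => exists i, U i a); split.
- by move=> n; have [dD _ _] := DU (q n).1; exact: dD.
- by move=> a b [i Ua]; exists i; have [_ Uup _] := DU i; exact: Uup.
- move=> u uD.
  have BU i : B i u <-> hits u (U i).
    have [_ _ BU] := DU i; apply: BU => n.
    by have := uD (pickle (i, n)); rewrite /q pickleK.
  split; first by move=> [i _ /BU [k Uk]]; exists k, i.
  by move=> [k [i Uk]]; exists i => //; apply/BU; exists k.
Qed.

End GenericSequences.

(** * Continuous preimages of Borel sets are almost open *)

Lemma prod_cvg (I : eqType) (K : I -> topologicalType) (S : Type)
    (F : set_system S) (FF : Filter F) (v : S -> prod_topology K)
    (x : prod_topology K) :
  (forall i, (fun s => v s i) @ F --> x i) -> v @ F --> x.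
Proof.
move=> vx; apply/cvg_sup => i U [V] [[W] oW <-] /= Wx /filterS; apply.
by apply: (vx i); apply: open_nbhs_nbhs; split.
Qed.

Section BorelAlmostOpen.
Variables (T : Type) (h : (nat -> T) -> cantor_sequences).
Hypothesis hcont : forall u n j, exists k, forall v,
  mkseq v k = mkseq u k -> (h v n : cantor_space) j = (h u n : cantor_space) j.

(** [hcont] expresses continuity for discrete [T], bit by bit. [U] collects the conditions whose
    basic open set is mapped into [O], so trivial dense sets suffice. *)
Lemma open_almost_open (O : set cantor_sequences) :
  open O -> almost_open (h @^-1` O).
Proof.
move=> oO; pose U a := forall u, mkseq u (size a) = a -> O (h u).
have trunc (u : nat -> T) (a b : seq T) :
    mkseq u (size (a ++ b)) = a ++ b -> mkseq u (size a) = a.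
  move=> /(congr1 (take (size a))); rewrite take_size_cat // => e.
  by rewrite -[RHS]e /mkseq -map_take take_iota size_cat (minn_idPl (leq_addr _ _)).
exists (fun _ _ => True), U; split.
- by move=> _ a; exists [::].
- by move=> a b Ua u /trunc; exact: Ua.
move=> u _; split; last by move=> [k]; apply; rewrite size_mkseq.
move=> Ohu; apply: contrapT => nU.
(* If no initial segment of [u] lies in [U], sequences agreeing with [u] for longer and longer are
   mapped outside [O], although their images converge to [h u]. *)
have /choice [v vP] : forall k, exists v, mkseq v k = mkseq u k /\ ~ O (h v).
  move=> k; apply: contrapT => nv; apply: nU; exists k => v.
  rewrite size_mkseq => e; apply: contrapT => nO; by apply: nv; exists v.
have vu : (fun k => h (v k)) @ \oo --> h u.
  apply: prod_cvg => n; apply: prod_cvg => j.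
  have [k hk] := hcont u n j.
  apply: (@cvg_near_cst).
  exists k => // l /= kl; apply: hk.
  have [vl _] := vP l.
  move: (congr1 (take k) vl).
  by rewrite /mkseq -!map_take take_iota (minn_idPl kl).
have /vu [k _ /(_ k (leqnn k))] : nbhs (h u) O by exact: open_nbhs_nbhs.
by have [] := vP k.
Qed.

Lemma borel_almost_open (B : set cantor_sequences) :
  borel B -> almost_open (h @^-1` B).
Proof.
have : sigma_algebra [set: cantor_sequences] [set B | almost_open (h @^-1` B)].
  split=> [|A|A] /=.
  - by apply: open_almost_open; exact: open0.
  - by rewrite setTD preimage_setC; exact: almost_openC.
  - by rewrite preimage_bigcup; exact: almost_open_bigcup.
by move=> /smallest_sub; apply => A; exact: open_almost_open.
Qed.

End BorelAlmostOpen.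

(** * Definability of inclusion between ranges *)

Lemma almost_open_sigma_algebra (T : Type) :
  sigma_algebra [set: nat -> T] (@almost_open T).
Proof.
split=> [|A|A].
- exists (fun _ _ => True), (fun _ => False); split=> [_ a|//|u _].
    by exists [::].
  by split=> [[]|[k []]].
- by rewrite setTD; exact: almost_openC.
- exact: almost_open_bigcup.
Qed.

(** Inclusion is a countable Boolean combination of conditions on single bits. The family [C] is
    abstract so as to cover both Borel and almost open sets. *)
Lemma sigma_algebra_subrange (Z : Type) (C : set (set Z))
    (p q : Z -> cantor_sequences) :
  sigma_algebra [set: Z] C ->
  (forall n k, C [set z | (p z n : cantor_space) k]) ->
  (forall n k, C [set z | (q z n : cantor_space) k]) ->
  C [set z | range (p z) `<=` range (q z)].
Proof.
move=> [C0 CD CU] Cp Cq.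
have CC A : C A -> C (~` A) by move=> /CD; rewrite setTD.
have CI (F : nat -> set Z) : (forall i, C (F i)) -> C (\bigcap_i F i).
  by move=> CF; rewrite -[\bigcap_i _]setCK setC_bigcap; apply/CC/CU => i; exact: CC.
have CU2 A B : C A -> C B -> C (A `|` B).
  by move=> CA CB; rewrite -bigcup2E; apply: CU => -[|[|i]].
have CI2 A B : C A -> C B -> C (A `&` B).
  by move=> CA CB; rewrite -[A `&` B]setCK setCI; apply/CC/CU2; exact: CC.
have Ceq n m k :
    C [set z | (p z n : cantor_space) k = (q z m : cantor_space) k].
  have -> : [set z | (p z n : cantor_space) k = (q z m : cantor_space) k] =
      ([set z | (p z n : cantor_space) k] `&` [set z | (q z m : cantor_space) k]) `|`
      (~` [set z | (p z n : cantor_space) k] `&` ~` [set z | (q z m : cantor_space) k]).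
    apply/seteqP; split=> z /=.
      by case: (p z n k : bool) => <-; [left|right].
    by case: (p z n k : bool); case: (q z m k : bool) => // -[] [].
  by apply: CU2; apply: CI2 => //; exact: CC.
have -> : [set z | range (p z) `<=` range (q z)] =
    \bigcap_n \bigcup_m \bigcap_k
      [set z | (p z n : cantor_space) k = (q z m : cantor_space) k].
  apply/seteqP; split=> [z /= pq n _|z pq _ [n _ <-]].
    have [m _ qm] : range (q z) (p z n) by apply: pq; exists n.
    by exists m => // k _ /=; rewrite qm.
  have [m _ qm] := pq n I; exists m => //.
  by apply/esym/funext => k; exact: (qm k I).
by apply: (CI) => n; apply: CU => m; apply: (CI) => k; exact: Ceq.
Qed.

Lemma continuous_bit n k :
  continuous (fun x : cantor_sequences => (x n : cantor_space) k : bool).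
Proof.
move=> x; apply: (@continuous_comp _ _ _ (fun x : cantor_sequences => x n)
  (fun z : cantor_space => z k)).
  exact: (@proj_continuous nat (fun=> cantor_space) n).
exact: (@proj_continuous nat (fun=> bool) k).
Qed.

Lemma continuous_borel_map (X Y : topologicalType) (f : X -> Y) :
  continuous f -> borel_map f.
Proof.
move=> cf B; suff /smallest_sub : sigma_algebra [set: Y] [set B | borel (f @^-1` B)].
  by apply=> O oO; apply: sub_sigma_algebra; apply: open_comp => // x _; exact: cf.
have [b0 bD bU] := smallest_sigma_algebra [set: X] open.
split=> [|A|A] /=; first by rewrite preimage_set0.
  by rewrite setTD preimage_setC -setTD; exact: bD.
by rewrite preimage_bigcup; exact: bU.
Qed.

Lemma borel_true : borel [set b : bool | b].
Proof. by apply: sub_sigma_algebra; exact: discrete_open. Qed.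

Lemma borel_bit n k : borel [set x : cantor_sequences | (x n : cantor_space) k].
Proof.
exact: (continuous_borel_map (@continuous_bit n k)) borel_true.
Qed.

Definition comparable_range (x y : cantor_sequences) : Prop :=
  range x `<=` range y \/ range y `<=` range x.

Lemma borel_comparable_range :
  borel [set p : cantor_sequences * cantor_sequences | comparable_range p.1 p.2].
Proof.
have sB : sigma_algebra [set: cantor_sequences * cantor_sequences] borel.
  exact: smallest_sigma_algebra.
have [_ _ bU] := sB.
have b1 n k : borel [set p : cantor_sequences * cantor_sequences |
    (p.1 n : cantor_space) k].
  apply: (continuous_borel_map _ borel_true).
  move=> p; apply: (@continuous_comp _ _ _ fst
    (fun x : cantor_sequences => (x n : cantor_space) k : bool)).
    exact: cvg_fst.
  exact: continuous_bit.
have b2 n k : borel [set p : cantor_sequences * cantor_sequences |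
    (p.2 n : cantor_space) k].
  apply: (continuous_borel_map _ borel_true).
  move=> p; apply: (@continuous_comp _ _ _ snd
    (fun x : cantor_sequences => (x n : cantor_space) k : bool)).
    exact: cvg_snd.
  exact: continuous_bit.
have -> : [set p : cantor_sequences * cantor_sequences | comparable_range p.1 p.2] =
    [set p | range p.1 `<=` range p.2] `|` [set p | range p.2 `<=` range p.1] by [].
rewrite -bigcup2E; apply: bU => -[|[|i]] /=.
- exact: (sigma_algebra_subrange sB).
- exact: (sigma_algebra_subrange sB).
- by case: sB.
Qed.

(** * Concatenation, and E_0-classes as countable sets *)

Section Concatenation.
Variable T : Type.
Implicit Types (a b : seq T) (u w : nat -> T) (P : seq T -> Prop).

Definition cat_fun a w : nat -> T :=
  fun i => if i < size a then nth (w 0) a i else w (i - size a).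

Lemma mkseq_cat_fun a w k : mkseq (cat_fun a w) (size a + k) = a ++ mkseq w k.
Proof.
apply: (@eq_from_nth _ (w 0)); first by rewrite size_cat !size_mkseq.
move=> i; rewrite size_mkseq => ik; rewrite nth_mkseq // nth_cat /cat_fun.
by have [//|ai] := ltnP i (size a); rewrite nth_mkseq // ltn_subLR.
Qed.

Lemma hits_cat_fun a w P : hits w (fun b => P (a ++ b)) -> hits (cat_fun a w) P.
Proof. by move=> [k Pk]; exists (size a + k); rewrite mkseq_cat_fun. Qed.

End Concatenation.

(** Enumerates the E_0-class of [u]: [n] codes a finite word that overwrites the beginning of [u], a
    non-code counting as the empty word. *)
Definition tail_class (u : nat -> bool) : cantor_sequences :=
  fun n i => let s := odflt [::] (unpickle n : option (seq bool)) in
             if i < size s then nth false s i else u i.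

Lemma range_tail_class u v :
  range (tail_class u) v <-> exists N, forall i, N <= i -> v i = u i.
Proof.
split=> [[n _ <-]|[N vu]].
  exists (size (odflt [::] (unpickle n : option (seq bool)))) => i.
  by rewrite /tail_class leqNgt => /negbTE ->.
exists (pickle (mkseq v N)) => //; apply/funext => i.
rewrite /tail_class pickleK /= size_mkseq.
by have [iN|/vu //] := ltnP i N; rewrite nth_mkseq.
Qed.

Lemma F2_tail_class u v :
  F2 (tail_class u) (tail_class v) <-> exists N, forall i, N <= i -> u i = v i.
Proof.
split=> [e|[N uv]].
  by apply/range_tail_class; rewrite -e; apply/range_tail_class; exists 0.
rewrite /F2; apply/seteqP; split=> w /range_tail_class [M wM];
  apply/range_tail_class; exists (maxn N M) => i; rewrite geq_max => /andP[Ni Mi].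
  by rewrite wM // uv.
by rewrite wM // uv.
Qed.

(** [P (m, k, v)] holds the conditions forcing bit [k] of coordinate [m] to be [v]. Conditions
    deciding a bit are dense, so a generic [u] decides all of them. *)
Lemma almost_open_decision (T : Type) (F : (nat -> T) -> cantor_sequences) :
  (forall m k, almost_open [set u | (F u m : cantor_space) k]) ->
  exists D : nat -> seq T -> Prop, exists P : nat * nat * bool -> seq T -> Prop,
    [/\ forall i, dense_cond (D i), forall j, upclosed (P j) &
        forall u, (forall i, hits u (D i)) ->
          (forall m k v, hits u (P (m, k, v)) -> (F u m : cantor_space) k = v) /\
          (forall m k, exists v, hits u (P (m, k, v)))].
Proof.
move=> aF.
have /choice [D /choice [U DU]] : forall mk : nat * nat,
    exists D : nat -> seq T -> Prop, exists U : seq T -> Prop,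
    [/\ forall n, dense_cond (D n), upclosed U &
        forall u, (forall n, hits u (D n)) ->
          ((F u mk.1 : cantor_space) mk.2 <-> hits u U)].
  by move=> [m k]; exact: aF.
(* The value [true] is forced by membership in the open set, [false] by having no extension in
   it. *)
pose P (j : nat * nat * bool) a :=
  if j.2 then U j.1 a else forall b, ~ U j.1 (a ++ b).
pose D' (i : nat * nat * option nat) a :=
  if i.2 is Some n then D i.1 n a else exists v, P (i.1, v) a.
have Pup j : upclosed (P j).
  move: j => [j [] a b]; rewrite /P /=; last by move=> Pa c; rewrite -catA.
  by have [_ Uup _] := DU j; exact: Uup.
exists (fun n a => if unpickle n is Some i then D' i a else True), P.
split=> // [n a|u uD'].
  case: (unpickle n) => [[j [l|]]|]; last by exists [::].
    by have [dD _ _] := DU j; exact: dD.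
  have [[b Ub]|nU] := pselect (exists b, U j (a ++ b)); first by exists b, true.
  by exists [::], false; rewrite cats0 /P /= => b Ub; apply: nU; exists b.
have {}uD' i : hits u (D' i) by have [k] := uD' (pickle i); rewrite pickleK; exists k.
have dec m k : exists v, hits u (P (m, k, v)).
  by have [l [v Pv]] := uD' (m, k, None); exists v, l.
split=> // m k v [l Pl].
have [_ Uup /(_ u) FU] := DU (m, k).
have {}FU := FU (fun n => uD' (m, k, Some n)).
case: v Pl => [Ul|nUl]; first by apply/FU; exists l.
apply/negP => /FU [l' Ul'].
have [b e] := mkseq_leq u (leq_maxl l l'); have [b' e'] := mkseq_leq u (leq_maxr l l').
by apply: (nUl b); rewrite -e e'; exact: Uup.
Qed.

(** * Countable sets closed under witnesses, and their generic enumerations *)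

Section ClosedRanges.
Variable T : Type.

(* Finite sequences from the countable set [range y] are written [map y l]. *)
Definition closed_under (J : Type) (Q : J -> seq T -> Prop) (y : nat -> T) :=
  forall j l, (exists b, Q j (map y l ++ b)) -> exists l', Q j (map y (l ++ l')).

(** [y] is itself obtained generically: requirements [inl] append missing witnesses, requirements
    [inr] append the values of [e]. *)
Lemma closed_extension (J : countType) (Q : J -> seq T -> Prop) (e : nat -> T) :
  exists2 y, closed_under Q y & range e `<=` range y.
Proof.
pose t0 := e 0.
pose R (i : J * seq nat + nat) c := match i with
  | inl (j, l) => all (gtn (size c)) l /\
      ((exists b, Q j (map (nth t0 c) l ++ b)) ->
       exists2 l', all (gtn (size c)) l' & Q j (map (nth t0 c) (l ++ l')))
  | inr i => exists2 j, j < size c & nth t0 c j = e i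
  end.
have extend c b l : all (gtn (size c)) l ->
    all (gtn (size (c ++ b))) l /\ map (nth t0 (c ++ b)) l = map (nth t0 c) l.
  move=> /allP lc; split.
    by apply/allP => i /lc /= ic; rewrite size_cat (leq_trans ic) // leq_addr.
  by apply/eq_in_map => i /lc /= ic; rewrite nth_cat ic.
have [y yR] : exists y, forall i, hits y (R i).
  apply: (generic_exists t0) => -[[j l]|i] c; last first.
    exists [:: e i], (size c); first by rewrite size_cat addn1.
    by rewrite nth_cat ltnn subnn.
  (* [sumn l] bounds every entry of [l], so the padding brings all these indices inside the list,
     where further extension leaves their values unchanged. *)
  pose c1 := c ++ nseq (sumn l).+1 t0.
  have lc1 : all (gtn (size c1)) l.
    apply/allP => i il; rewrite /= /c1 size_cat size_nseq addnS ltnS.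
    rewrite (leq_trans _ (leq_addl _ _)) // sumnE (big_rem i) //=.
    exact: leq_addr.
  have [[b Qb]|nQ] := pselect (exists b, Q j (map (nth t0 c1) l ++ b)); last first.
    by exists (nseq (sumn l).+1 t0); split=> // -[b Qb]; case: nQ; exists b.
  exists (nseq (sumn l).+1 t0 ++ b); rewrite catA -/c1.
  have [lc1b e1] := extend c1 b l lc1; split=> // _.
  exists (iota (size c1) (size b)).
    by apply/allP => i; rewrite mem_iota /= size_cat => /andP[].
  rewrite map_cat e1.
  have -> : map (nth t0 (c1 ++ b)) (iota (size c1) (size b)) = b => //.
  apply: (@eq_from_nth _ t0); first by rewrite size_map size_iota.
  move=> i; rewrite size_map size_iota => ib.
  by rewrite (nth_map 0) ?size_iota // nth_iota // nth_cat ltnNge leq_addr /= addKn.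
have ymap k l : all (gtn k) l -> map (nth t0 (mkseq y k)) l = map y l.
  by move=> /allP lk; apply/eq_in_map => i /lk /= ik; rewrite nth_mkseq.
exists y.
  move=> j l exQ; have [k] := yR (inl (j, l)); rewrite /= size_mkseq => -[lk].
  rewrite ymap // => /(_ exQ) [l' l'k]; rewrite ymap ?all_cat ?lk //.
  by exists l'.
move=> _ [i _ <-]; have [k [j]] := yR (inr i); rewrite size_mkseq => jk.
by rewrite nth_mkseq // => <-; exists j.
Qed.

(** Requirement [inr n] puts [n] among the values of [g], which keeps the range of [y]. Density of
    [D] is asked only along tuples from that range. *)
Lemma generic_enumeration (J : countType) (D : J -> seq T -> Prop) (y : nat -> T)
    (l0 : seq nat) (E : nat -> seq nat -> Prop) :
  (forall i l, exists l', D i (map y (l ++ l'))) ->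
  (forall i, dense_cond (E i)) ->
  exists g : nat -> nat, [/\ range (y \o g) = range y, mkseq g (size l0) = l0,
    forall i, hits (y \o g) (D i) & forall i, hits g (E i)].
Proof.
move=> dD dE.
pose R (i : J + nat + nat) (b : seq nat) := match i with
  | inl (inl j) => D j (map y (l0 ++ b))
  | inl (inr n) => E n (l0 ++ b)
  | inr n => n \in b
  end.
have [w wR] : exists w, forall i, hits w (R i).
  apply: (generic_exists 0) => -[[j|n]|n] b.
  - by have [b' Db'] := dD j (l0 ++ b); exists b'; rewrite /= catA.
  - by have [b' Eb'] := dE n (l0 ++ b); exists b'; rewrite /= catA.
  - by exists [:: n]; rewrite /= mem_cat inE eqxx orbT.
have mkg k := mkseq_cat_fun l0 w k.
exists (cat_fun l0 w); split.
- apply/seteqP; split=> _ [n _ <-]; first by exists (cat_fun l0 w n).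
  have [k /mapP[i _ ->]] := wR (inr n).
  exists (size l0 + i) => //=.
  by rewrite /cat_fun ltnNge leq_addr /= addKn.
- by rewrite -[X in mkseq _ X]addn0 mkg cats0.
- move=> i; have [k Dk] := wR (inl (inl i)); exists (size l0 + k).
  by rewrite /mkseq map_comp -/(mkseq _ _) mkg.
- by move=> i; exact: (hits_cat_fun (wR (inl (inr i)))).
Qed.

End ClosedRanges.

(** * Ranges of images under a reduction of [F2] to itself *)

Section Reduction.
Variable Phi : cantor_sequences -> cantor_sequences.
Hypothesis Phi_borel : borel_map Phi.
Hypothesis Phi_red : forall x y, F2 x y <-> F2 (Phi x) (Phi y).

Lemma incomparable_images :
  exists x y, ~ F2 x y /\ ~ comparable_range (Phi x) (Phi y).
Proof.
apply: contrapT => nex.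
have comp x y : ~ F2 x y -> comparable_range (Phi x) (Phi y).
  by move=> nxy; apply: contrapT => nc; apply: nex; exists x, y.
pose neg (u : nat -> bool) : nat -> bool := fun i => ~~ u i.
pose B := [set u | range (Phi (tail_class u)) `<=` range (Phi (tail_class (neg u)))].
(* [s = false] gives the sequence itself and [s = true] its complement, so both sides of the
   inclusion in [B] are treated at once. *)
have tcont (s : bool) u n j : exists k, forall v, mkseq v k = mkseq u k ->
    (tail_class (fun i => s (+) v i) n : cantor_space) j =
    (tail_class (fun i => s (+) u i) n : cantor_space) j.
  exists j.+1 => v /(congr1 (nth false ^~ j)); rewrite !nth_mkseq // => vj.
  by rewrite /tail_class vj.
have abit (s : bool) n k : almost_open
    [set u | (Phi (tail_class (fun i => s (+) u i)) n : cantor_space) k].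
  apply: (borel_almost_open (tcont s)
    (B := Phi @^-1` [set x | (x n : cantor_space) k])).
  by apply: Phi_borel; exact: borel_bit.
have [D [U [dD _ BU]]] : almost_open B.
  apply: (sigma_algebra_subrange (@almost_open_sigma_algebra bool)) => n k.
    exact: (abit false).
  exact: (abit true).
(* Among generic sequences beginning with [a], membership in [B] is constant: either [a] is in [U]
   or [U] is empty. *)
have [a aU] : exists a, (exists b, U b) -> U a.
  by have [[a Ua]|nU] := pselect (exists a, U a); [exists a|exists [::]].
(* One [w] such that both [w] and its complement are generic after [a]. *)
have [w wD] : exists w, forall i : nat * bool,
    hits w (fun b => D i.1 (a ++ map (addb i.2) b)).
  apply: (generic_exists false) => -[n s] b /=.
  have [c Dc] := dD n (a ++ map (addb s) b).
  exists (map (addb s) c).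
  by rewrite map_cat (mapK (addKb s)) catA.
(* Both begin with [a], so [B] cannot separate them, and [y] agrees with the complement of [x]
   beyond [a]. *)
pose x := cat_fun a w; pose y := cat_fun a (neg w).
have BE z : (forall n, hits z (fun b => D n b)) -> mkseq z (size a) = a ->
    B z <-> exists b, U b.
  move=> zD za; rewrite BU //; split; first by move=> [k Uk]; exists (mkseq z k).
  by move=> /aU Ua; exists (size a); rewrite za.
have pre v : mkseq (cat_fun a v) (size a) = a.
  by rewrite -[X in mkseq _ X]addn0 mkseq_cat_fun cats0.
have xD n : hits x (D n).
  apply: hits_cat_fun; have [k Dk] := wD (n, false); exists k.
  by move: Dk; rewrite /= map_id.
have yD n : hits y (D n).
  apply: hits_cat_fun; have [k Dk] := wD (n, true); exists k.
  by move: Dk; rewrite /= /mkseq -map_comp.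
have Bxy : B x <-> B y by rewrite (BE _ xD (pre w)) (BE _ yD (pre (neg w))).
have tail v v' : (forall i, size a <= i -> v i = v' i) ->
    range (Phi (tail_class v)) = range (Phi (tail_class v')).
  move=> vv'; apply: (proj1 (Phi_red _ _)).
  by apply/F2_tail_class; exists (size a).
have Ey : range (Phi (tail_class y)) = range (Phi (tail_class (neg x))).
  by apply: tail => i; rewrite /neg /y /x /cat_fun leqNgt => /negbTE ->.
have Eny : range (Phi (tail_class (neg y))) = range (Phi (tail_class x)).
  by apply: tail => i; rewrite /neg /y /x /cat_fun leqNgt => /negbTE ->; rewrite negbK.
have nF : ~ F2 (tail_class x) (tail_class (neg x)).
  by move=> /F2_tail_class [N /(_ N (leqnn N))]; rewrite /neg; case: (x N).
(* The opposite inclusion is [B y] up to E_0, hence also gives [B x]. *)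
have Bx : B x.
  have [//|le] := comp _ _ nF.
  by apply/Bxy; rewrite /B /= Ey Eny.
apply: nF; apply: (proj2 (Phi_red _ _)); apply/seteqP; split; first exact: Bx.
by move/Bxy: Bx; rewrite /B /= Ey Eny.
Qed.

Lemma comparable_images :
  exists x y, ~ F2 x y /\ comparable_range (Phi x) (Phi y).
Proof.
have abit m k : almost_open
    [set u : nat -> cantor_space | (Phi u m : cantor_space) k].
  apply: (@borel_almost_open _ (fun u => u) _
    (Phi @^-1` [set x | (x m : cantor_space) k])).
    move=> u n j; exists n.+1 => v /(congr1 (nth (u 0) ^~ n)).
    by rewrite !nth_mkseq // => ->.
  by apply: Phi_borel; exact: borel_bit.
have [D [P [dD Pup DP]]] := almost_open_decision abit.
(* Closure under [D] provides generic enumerations of the range; closure under [P] replaces an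
   arbitrary deciding extension by one inside the range. *)
pose Q (i : nat + nat * nat * bool) := match i with inl i => D i | inr j => P j end.
(* Weak forcing: no extension of [a] decides a bit of coordinate [m] against [z]. *)
pose forces a m (z : cantor_space) := forall k b, ~ P (m, k, ~~ z k) (a ++ b).
have rangeP (y : cantor_sequences) z : closed_under Q y ->
    range (Phi y) z <-> exists l m, forces (map y l) m z.
  move=> cy.
  have cD i l : exists l', D i (map y (l ++ l')).
    by apply: (cy (inl i)); exact: dD.
  split=> [rz|[l [m fz]]]; last first.
    (* Enumerate the same set generically, beginning with [l]: a bit of coordinate [m] differing
       from [z] would be decided by an extension of [map y l]. *)
    have [g [rg gl gD _]] := generic_enumeration (E := fun _ _ => True) l cD
      (fun _ _ => ex_intro _ [::] I).
    have -> : range (Phi y) = range (Phi (y \o g)).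
      by apply: (proj1 (Phi_red _ _)); rewrite /F2 rg.
    exists m => //; apply/funext => k.
    have [val dec] := DP _ gD.
    have [v vP] := dec m k.
    rewrite (val m k v vP); apply: contrapT => vz.
    have {vz} ev : v = ~~ z k by move: vz; case: (v); case: (z k).
    have [n Pn] := vP.
    have [b e] := mkseq_leq (y \o g) (leq_maxl n (size l)).
    have [b' e'] := mkseq_leq (y \o g) (leq_maxr n (size l)).
    apply: (fz k b'); rewrite -ev.
    have -> : map y l = mkseq (y \o g) (size l).
      by rewrite -{1}gl /mkseq -map_comp.
    by rewrite -e' e; exact: Pup.
  (* If nothing forces [z], contradicting [z] at any given coordinate is dense, so the image of some
     generic enumeration omits [z]. *)
  apply: contrapT => nf.
  have dE m : dense_cond (fun l => exists k, P (m, k, ~~ z k) (map y l)).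
    move=> l; apply: contrapT => nl; apply: nf; exists l, m => k b Pb.
    have [|l' Pl'] := cy (inr (m, k, ~~ z k)) l; first by exists b.
    by apply: nl; exists l', k.
  have [g [rg _ gD gE]] := generic_enumeration [::] cD dE.
  move: rz; have -> : range (Phi y) = range (Phi (y \o g)).
    by apply: (proj1 (Phi_red _ _)); rewrite /F2 rg.
  move=> [m _ mz]; have [n [k Pk]] := gE m.
  have [val _] := DP _ gD.
  have : (Phi (y \o g) m : cantor_space) k = ~~ z k.
    by apply: val; exists n; rewrite /mkseq map_comp.
  by rewrite mz; case: (z k).
have [x cx _] := closed_extension Q (fun _ _ => false).
(* A diagonal real outside [range x]; placing it in [range y] makes [x] and [y] inequivalent. *)
pose r : cantor_space := fun n => ~~ (x n : nat -> bool) n.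
have [y cy xy] := closed_extension Q (fun n => if n is n'.+1 then x n' else r).
have sxy : range x `<=` range y.
  by move=> _ [n _ <-]; apply: xy; exists n.+1.
exists x, y; split.
  rewrite /F2 => e; have : range x r by rewrite e; apply: xy; exists 0.
  by move=> [n _ /(congr1 (fun f : nat -> bool => f n))]; rewrite /r; case: (x n n).
(* Forcing depends only on the tuple, and a tuple from [range x] can be re-indexed through [y]. *)
left=> z /(rangeP _ _ cx) [l [m fz]]; apply/(rangeP _ _ cy).
have /choice [g xg] : forall n, exists n', y n' = x n.
  by move=> n; have [|n' _ e] := sxy (x n); [exists n|exists n'].
exists (map g l), m; rewrite -map_comp.
by rewrite (eq_map (_ : y \o g =1 x)).
Qed.

End Reduction.

Theorem theorem2 : ~ borel_weakly_compact F2.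
Proof.
pose f (p : cantor_sequences * cantor_sequences) := `[<comparable_range p.1 p.2>].
move=> /(_ f) [].
- have bf (b : bool) : borel (f @^-1` [set b]).
    have bt := borel_comparable_range.
    have -> : f @^-1` [set b] = if b then [set p | comparable_range p.1 p.2]
        else ~` [set p | comparable_range p.1 p.2].
      apply/seteqP; case: b; split=> p /=; rewrite /f.
      - by move/asboolP.
      - by move/asboolP.
      - by move/asboolP.
      - by move=> np; apply/asboolP.
    have [_ bD _] :=
    smallest_sigma_algebra [set: cantor_sequences * cantor_sequences] open.
    by case: b => //; rewrite -setTD; exact: bD.
  move=> B _.
  have -> : f @^-1` B = \bigcup_n (if n is 0 then f @^-1` (B `&` [set true])
                                   else f @^-1` (B `&` [set false])).
    apply/seteqP; split=> [p Bp|p [[|n] _ []] //].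
    by case e : (f p); [exists 0|exists 1] => //; split; rewrite /= ?e // -e.
  have [b0 _ bU] :=
    smallest_sigma_algebra [set: cantor_sequences * cantor_sequences] open.
  have bB b : borel (f @^-1` (B `&` [set b])).
    have [Bb|nBb] := pselect (B b).
      rewrite (_ : B `&` [set b] = [set b]) //.
      by apply/seteqP; split=> [c []//|c ->].
    rewrite (_ : B `&` [set b] = set0) ?preimage_set0 //.
    by apply/seteqP; split=> [c [Bc cb]|//]; apply: nBb; rewrite -cb.
  by apply: bU => -[|n]; exact: bB.
- by move=> x y; apply: asbool_equiv_eq; rewrite /comparable_range /= orC.
- by move=> x x' y y' exx eyy; rewrite /f /comparable_range /= exx eyy.
move=> A [_ [phi bphi phi_red] [c cA]].
(* Followed by the inclusion of [A], the reduction becomes one of [F2] to itself with values in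
   [A]. *)
pose Phi x : cantor_sequences := set_val (phi x).
have Phi_borel : borel_map Phi.
  move=> B bB; apply: (bphi (set_val @^-1` B)).
  apply: (continuous_borel_map _ bB); exact: initial_continuous.
have Phi_red x y : F2 x y <-> F2 (Phi x) (Phi y) by exact: phi_red.
have PhiA x : A (Phi x) by exact: set_valP.
have fc x y : ~ F2 x y -> f (Phi x, Phi y) = c.
  by move=> nxy; apply: cA => //; rewrite -Phi_red.
case: c fc {cA} => fc.
  have [x [y [nxy nc]]] := incomparable_images Phi_borel Phi_red.
  by apply: nc; apply/asboolP; exact: fc.
have [x [y [nxy xy]]] := comparable_images Phi_borel Phi_red.
by have /asboolP := fc _ _ nxy; apply.
Qed.
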